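(* Let $\mathcal{H}$ be a real Hilbert space, let $\mathcal{A}:\mathcal{H}\to2^{\mathcal{H}}$ be a maximal monotone operator with $\operatorname{zer}(\mathcal{A})\neq\emptyset$, and let $\mathcal{M}$ be an admissible preconditioner for $\mathcal{A}$ such that $(\mathcal{M}+\mathcal{A})^{-1}$ is Lipschitz continuous. Let $\{x^k\}$ be the sequence generated by the PHA iteration with $T=(\mathcal{M}+\mathcal{A})^{-1}\mathcal{M}$. Then $\{x^k\}$ converges strongly to a point of $\operatorname{zer}(\mathcal{A})$.
   Context: Notation: $\operatorname{zer}(\mathcal{A})=\{x\in\mathcal{H}:0\in\mathcal{A}x\}$; $\langle x,y\rangle_{\mathcal{M}}=\langle \mathcal{M}x,y\rangle$; $\|x\|_{\mathcal{M}}=\sqrt{\langle x,x\rangle_{\mathcal{M}}}$. An admissible preconditioner for $\mathcal{A}$ is a linear, bounded, self-adjoint, positive semidefinite operator $\mathcal{M}:\mathcal{H}\to\mathcal{H}$ such that $(\mathcal{M}+\mathcal{A})^{-1}\mathcal{M}$ is single-valued and has full domain. Lipschitz continuity of $(\mathcal{M}+\mathcal{A})^{-1}$ (on its domain) means that for some $L$, $\|a-b\|\le L\|x-y\|$ whenever $a\in(\mathcal{M}+\mathcal{A})^{-1}x$ and $b\in(\mathcal{M}+\mathcal{A})^{-1}y$. PHA iteration (preconditioned Halpern iteration with adaptive anchoring parameters): given $x^0\in\mathcal{H}$, for $k=1,2,\dots$ set $$x^k=\frac{1}{\varphi_k+1}x^0+\frac{\varphi_k}{\varphi_k+1}Tx^{k-1},\qquad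 \varphi_k=\frac{2\langle x^{k-1}-Tx^{k-1},\,x^0-x^{k-1}\rangle_{\mathcal{M}}}{\|x^{k-1}-Tx^{k-1}\|_{\mathcal{M}}^2}+1.$$ It is assumed that $\|x^{k-1}-Tx^{k-1}\|_{\mathcal{M}}\neq 0$ for every $k\ge1$, so that all $\varphi_k$ are defined and the iteration produces an infinite sequence. *)

(* Defs.v *)
From HB Require Import structures.
From mathcomp Require Import all_boot all_order all_algebra.
From mathcomp Require Import all_classical all_reals all_analysis.

Set Implicit Arguments.
Unset Strict Implicit.
Unset Printing Implicit Defensive.
Import Order.TTheory GRing.Theory Num.Theory.
Import numFieldNormedType.Exports.

Local Open Scope classical_set_scope.
Local Open Scope ring_scope.

(* A real Hilbert space is a complete normed R-module H together with a
   positive definite symmetric bilinear form [dot] that induces its norm. *)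
Definition induces_norm (R : realType) (H : completeNormedModType R)
    (dot : {dot H for idfun}) : Prop :=
  forall x : H, `|x| = Num.sqrt (dot x x).

Section SetValuedOperators.
Context {R : realType} {H : completeNormedModType R}.
Implicit Types (A B : H -> set H) (dot : {dot H for idfun}) (f : H -> H).

Definition op_fun f : H -> set H := fun x => [set f x].

Definition op_add A B : H -> set H :=
  fun x => [set w | exists u v, [/\ A x u, B x v & w = u + v]].

Definition op_inv A : H -> set H := fun y => [set x | A x y].

Definition op_comp A B : H -> set H := fun x => \bigcup_(y in B x) A y.

Definition zer A : set H := [set x | A x 0].

Definition single_valued A : Prop :=
  forall x u v, A x u -> A x v -> u = v.

Definition full_domain A : Prop := forall x, A x !=set0.

(* the Lipschitz inequality is only tested on the domain of A *)
Definition op_lipschitz A : Prop :=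
  exists L : R, forall x y a b, A x a -> A y b -> `|a - b| <= L * `|x - y|.

Definition monotone_op dot A : Prop :=
  forall x y u v, A x u -> A y v -> 0 <= dot (x - y) (u - v).

(* no monotone operator has a graph strictly larger than that of A *)
Definition maximal_monotone dot A : Prop :=
  monotone_op dot A /\
  forall B, monotone_op dot B -> (forall x, A x `<=` B x) ->
    forall x, B x `<=` A x.

End SetValuedOperators.

Section Preconditioner.
Context {R : realType} {H : completeNormedModType R}.
Implicit Types (A : H -> set H) (dot : {dot H for idfun}) (M : {linear H -> H}).

Definition bounded_op M : Prop :=
  exists C : R, forall x, `|M x| <= C * `|x|.

Definition self_adjoint dot M : Prop :=
  forall x y, dot (M x) y = dot x (M y).

Definition positive_semidefinite dot M : Prop :=
  forall x, 0 <= dot (M x) x.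

Definition precond_resolvent A M : H -> set H :=
  op_comp (op_inv (op_add (op_fun M) A)) (op_fun M).

Definition admissible_preconditioner dot A M : Prop :=
  [/\ bounded_op M, self_adjoint dot M, positive_semidefinite dot M,
      single_valued (precond_resolvent A M) &
      full_domain (precond_resolvent A M)].

Definition dotM dot M (x y : H) : R := dot (M x) y.

Definition normM dot M (x : H) : R := Num.sqrt (dotM dot M x x).

Definition pha_phi dot M (T : H -> H) (x : nat -> H) (k : nat) : R :=
  2 * dotM dot M (x k.-1 - T (x k.-1)) (x 0%N - x k.-1)
    / normM dot M (x k.-1 - T (x k.-1)) ^+ 2 + 1.

Definition pha_iteration dot M (T : H -> H) (x : nat -> H) : Prop :=
  forall k : nat, (1 <= k)%N ->
    let phi := pha_phi dot M T x k in
    x k = (1 / (phi + 1)) *: x 0%N + (phi / (phi + 1)) *: T (x k.-1).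

End Preconditioner.

(* Main.v *)
Require Import Defs.
From HB Require Import structures.
From mathcomp Require Import all_boot all_order all_algebra.
From mathcomp Require Import all_classical all_reals all_analysis.
From mathcomp Require Import ring lra.
Import Order.TTheory GRing.Theory Num.Theory.
Import numFieldNormedType.Exports.
Local Open Scope classical_set_scope.
Local Open Scope ring_scope.

(** Write [B x y] for the form [dotM dot M x y] and [q] for its seminorm.
    Positivity of [M] makes [B] a semi-inner product, possibly degenerate, and
    monotonicity of [A] makes [T = (M + A)^-1 M] nonexpansive for [q]; its
    fixed points are the zeros of [A].  Since [(M + A)^-1] is Lipschitz and
    [|M v| <= sqrt C * q v] for a bound [C] of [M], [T] is also Lipschitz from
    [q] to the norm.  This last fact replaces completeness of [q]: as soon as a
    sequence is [q]-Cauchy, its image under [T] converges in norm.  So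
    everything is proved for a map [T] that is nonexpansive for a semi-inner
    product [B], Lipschitz from [q] to the norm and has a fixed point [p]
    ([pha_cvg]).

    Put [r_k = x_k - T x_k] and let [phi_k] be the parameter that produces
    [x_(k+1)].  The choice of [phi_k] is the one for which nonexpansiveness
    between [x_(k+1)] and [x_k] reads [phi_k + 1 <= phi_(k+1)] ([phi_step]);
    hence [phi_k >= k + 1], and [phi_k * q r_k <= 2 q (x_0 - p)]
    ([residual_le]), so the residuals tend to zero.  With the anchoring weights
    [a_k = 1 / (phi_k + 1)] there are two cases, because the [phi_k] may grow
    much faster than linearly.

    If the sum of the [a_k] is finite, the residual bound makes the steps
    [q (x_(k+1) - x_k)] summable ([pha_step_le]); so [T x_k] converges in norm,
    and [x_k] has the same limit since [a_k] tends to zero.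

    If the sum is infinite, the classical argument for Halpern's iteration
    applies: [halpern_step] is a recursive inequality that forces
    [q (x_k - z)] to zero provided the limsup of [B (x_0 - z) (x_k - z)] is at
    most zero.  A fixed point [z] with that property is the limit of the path
    [z_t = t x_0 + (1 - t) T z_t] as [t] decreases to zero
    ([browder_limit]).  Monotonicity of [I - T] gives the convergence of this
    path by a direct Cauchy estimate, and the limsup bound by comparing [x_k]
    with [z_t]. *)

(** * Semi-inner products *)

Record semi_inner {R : realType} {V : lmodType R} (B : V -> V -> R) : Prop :=
  SemiInner {
    semi_innerC : forall x y, B x y = B y x;
    semi_innerDl : forall x y z, B (x + y) z = B x z + B y z;
    semi_innerZl : forall a x y, B (a *: x) y = a * B x y;
    semi_inner_ge0 : forall x, 0 <= B x x }.

Arguments semi_innerC {R V B} _ x y.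
Arguments semi_innerDl {R V B} _ x y z.
Arguments semi_innerZl {R V B} _ a x y.
Arguments semi_inner_ge0 {R V B} _ x.

Definition seminorm {R : realType} {V : lmodType R} (B : V -> V -> R) (x : V) :=
  Num.sqrt (B x x).

Section SemiInnerTheory.
Context {R : realType} {V : lmodType R} {B : V -> V -> R}.
Hypothesis hB : semi_inner B.

Let BC := semi_innerC hB.
Let BDl := semi_innerDl hB.
Let BZl := semi_innerZl hB.
Let Bge0 := semi_inner_ge0 hB.

Lemma semi_innerNl x y : B (- x) y = - B x y.
Proof. by rewrite -scaleN1r BZl mulN1r. Qed.

Lemma semi_innerDr x y z : B x (y + z) = B x y + B x z.
Proof. by rewrite BC BDl BC (BC z). Qed.

Lemma semi_innerZr a x y : B x (a *: y) = a * B x y.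
Proof. by rewrite BC BZl BC. Qed.

Lemma semi_innerNr x y : B x (- y) = - B x y.
Proof. by rewrite BC semi_innerNl BC. Qed.

Definition semi_innerE := (semi_innerDl hB, semi_innerZl hB, semi_innerNl,
  semi_innerDr, semi_innerZr, semi_innerNr).

Lemma seminorm_ge0 x : 0 <= seminorm B x.
Proof. exact: sqrtr_ge0. Qed.

Lemma sqr_seminorm x : seminorm B x ^+ 2 = B x x.
Proof. exact: sqr_sqrtr. Qed.

Lemma seminorm_le x a : 0 <= a -> (seminorm B x <= a) = (B x x <= a ^+ 2).
Proof. by move=> a0; rewrite -sqr_seminorm ler_sqr ?nnegrE ?seminorm_ge0. Qed.

Lemma seminorm0 : seminorm B 0 = 0.
Proof. by rewrite /seminorm -(scale0r 0) BZl mul0r sqrtr0. Qed.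

Lemma seminormN x : seminorm B (- x) = seminorm B x.
Proof. by rewrite /seminorm !semi_innerE opprK. Qed.

Lemma seminormBC x y : seminorm B (x - y) = seminorm B (y - x).
Proof. by rewrite -seminormN opprB. Qed.

Lemma seminormZ a x : 0 <= a -> seminorm B (a *: x) = a * seminorm B x.
Proof.
move=> a0; rewrite /seminorm !semi_innerE mulrA -expr2 sqrtrM ?sqr_ge0//.
by rewrite sqrtr_sqr ger0_norm.
Qed.

(** Nonnegativity of [B (x - t y) (x - t y)] for all [t]; a vector [y] with
    [B y y = 0] need not vanish, so that case uses a [t] chosen to make the
    then affine expression negative. *)
Lemma semi_inner_sqr_le x y : B x y ^+ 2 <= B x x * B y y.
Proof.
have H t : 0 <= B x x - 2 * t * B x y + t ^+ 2 * B y y.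
  have := Bge0 (x - t *: y); rewrite !semi_innerE (BC y x).
  by congr (0 <= _); ring.
have [y0|y0] := eqVneq (B y y) 0.
  rewrite y0 mulr0; have [->|xy0] := eqVneq (B x y) 0; first by rewrite expr0n.
  have := H ((B x x + 1) / (2 * B x y)).
  rewrite y0 mulr0 addr0.
  have -> : 2 * ((B x x + 1) / (2 * B x y)) * B x y = B x x + 1 by field.
  by lra.
have yp : 0 < B y y by rewrite lt0r y0 Bge0.
have := H (B x y / B y y).
have -> : B x x - 2 * (B x y / B y y) * B x y + (B x y / B y y) ^+ 2 * B y y =
  (B x x * B y y - B x y ^+ 2) / B y y by field.
by rewrite pmulr_lge0 ?invr_gt0// subr_ge0.
Qed.

Lemma semi_inner_le x y : B x y <= seminorm B x * seminorm B y.
Proof.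
rewrite (le_trans (ler_norm _))// -sqrtr_sqr -sqrtrM//.
exact/ler_wsqrtr/semi_inner_sqr_le.
Qed.

Lemma seminormD x y : seminorm B (x + y) <= seminorm B x + seminorm B y.
Proof.
rewrite seminorm_le ?addr_ge0 ?seminorm_ge0// sqrrD !sqr_seminorm.
rewrite !semi_innerE (BC y x); have := semi_inner_le x y; lra.
Qed.

Lemma seminormB x y : seminorm B (x - y) <= seminorm B x + seminorm B y.
Proof. by rewrite -(seminormN y) seminormD. Qed.

End SemiInnerTheory.

(** * Convergence criteria *)

(** The quadratic form of the hypothesis is the one in which both the path
    estimate [path_increment] and summable steps present themselves. *)
Lemma cvg_of_increments (R : realType) (H : completeNormedModType R)
    (u : nat -> H) (s : nat -> R) (b : R) :
  (forall n m, (n <= m)%N -> `|u m - u n| ^+ 2 <= s m - s n) ->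
  (forall n, s n <= b) -> cvgn u.
Proof.
move=> us sb.
have s_nd : nondecreasing_seq s.
  by move=> n m nm; rewrite -subr_ge0 (le_trans _ (us _ _ nm))// sqr_ge0.
have s_cvg : cvgn s.
  by apply: nondecreasing_is_cvgn => //; exists b => _ [n _ <-].
apply: cauchy_cvg; apply: cauchy_exP => e e0.
have e20 : 0 < e ^+ 2 by rewrite exprn_gt0.
have [N _ sN] := (cvgrPdist_lt s (limn s)).1 s_cvg _ e20.
exists (u N), N => //= m Nm.
rewrite -ball_normE/= distrC -(@ltr_pXn2r _ 2)// ?nnegrE ?(ltW e0)//.
rewrite (le_lt_trans (us _ _ Nm))//.
rewrite (le_lt_trans _ (sN N (leqnn N)))// (le_trans _ (ler_norm _))//.
by rewrite lerD2r nondecreasing_cvgn_le.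
Qed.

Lemma anchored_cvg (R : realType) (H : normedModType R) (a : nat -> R)
    (w v : nat -> H) (x0 z : H) :
  a n @[n --> \oo] --> 0 -> v n @[n --> \oo] --> z ->
  (forall n, w n = a n *: x0 + (1 - a n) *: v n) ->
  w n @[n --> \oo] --> z.
Proof.
move=> a0 vz wE.
rewrite (_ : w = fun n => a n *: x0 + (1 - a n) *: v n); last exact/funext.
rewrite -[z in X in _ --> X]add0r -[X in _ --> X + _](scale0r x0).
rewrite -[X in _ --> _ + X]scale1r -[X in _ --> _ + X *: _](subr0 1).
apply: cvgD; apply: cvgZ => //; first exact: cvg_cst.
by apply: cvgB => //; exact: cvg_cst.
Qed.

(** While [e k > 2 d] each step decreases [e] by at least [a k * d], which
    the divergence of the sum of the weights forbids forever; once
    [e k <= 2 d] the inequality, an average of [e k] and [d], keeps it so. *)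
Lemma averaged_eventually_le (R : realType) (e a : nat -> R) (d : R) (N : nat) :
  0 < d -> (forall k, 0 <= e k) -> (forall k, 0 <= a k <= 1) ->
  (forall k, (N <= k)%N -> e k.+1 <= (1 - a k) * e k + a k * d) ->
  (forall b, exists n, b < \sum_(i < n) a i) ->
  \forall k \near \oo, e k <= 2 * d.
Proof.
move=> d0 e0 a01 ea a_unbounded.
have [[j Nj ej]|nj] := pselect (exists2 j, (N <= j)%N & e j <= 2 * d).
  suff H k : (j <= k)%N -> e k <= 2 * d by exists j.
  elim: k => [|k IH]; first by rewrite leqn0 => /eqP j0; rewrite j0 in ej.
  rewrite leq_eqVlt => /predU1P[<-//|]; rewrite ltnS => jk.
  have := IH jk; have := ea k (leq_trans Nj jk); have := a01 k.
  by move=> /andP[? ?]; nra.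
have {nj} big k : (N <= k)%N -> 2 * d < e k.
  by move=> Nk; rewrite ltNge; apply/negP => ek; apply: nj; exists k.
pose S n := \sum_(i < n) a i.
have S_nd : nondecreasing_seq S.
  apply/nondecreasing_seqP => n; rewrite /S big_ord_recr/=.
  by have /andP[? _] := a01 n; lra.
have bound k : (N <= k)%N -> e k + d * S k <= e N + d * S N.
  elim: k => [|k IH]; first by rewrite leqn0 => /eqP ->.
  rewrite leq_eqVlt => /predU1P[<-//|]; rewrite ltnS => Nk.
  have := IH Nk; have := ea k Nk; have := big k Nk.
  have /andP[? _] := a01 k; rewrite /S big_ord_recr/= -/(S k); nra.
have [n] := a_unbounded ((e N + d * S N) / d).
rewrite -/(S n) ltr_pdivrMr// mulrC ltNge => /negP[].
have [nN|/ltnW Nn] := leqP n N.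
  by have := S_nd _ _ nN; have := e0 N; nra.
by have := bound n Nn; have := e0 n; lra.
Qed.

(** * Nonexpansive maps for a degenerate semi-inner product *)

Section DegenerateNonexpansive.
Context {R : realType} {H : completeNormedModType R}.
Context {B : H -> H -> R} {T : H -> H} {C K : R}.
Hypothesis hB : semi_inner B.
Local Notation q := (seminorm B).
Hypothesis K_ge0 : 0 <= K.
Hypothesis q_le : forall v, q v <= C * `|v|.
Hypothesis T_nonexpansive : forall u v, q (T u - T v) <= q (u - v).
Hypothesis T_lip : forall u v, `|T u - T v| <= K * q (u - v).

Let BE := semi_innerE hB.
Let BC := semi_innerC hB.

Lemma T_cvg_of_q0 (w : nat -> H) z :
  q (w n - z) @[n --> \oo] --> 0 -> T (w n) @[n --> \oo] --> T z.
Proof.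
move=> qw; apply/cvgrPdist_le => e e0.
have Kq : K * q (w n - z) @[n --> \oo] --> 0.
  by rewrite -(mulr0 K); apply: cvgM => //; exact: cvg_cst.
have {}Kq := cvgr0_norm_le _ Kq _ e0.
near=> n; rewrite distrC (le_trans (T_lip _ _))// (le_trans (ler_norm _))//.
by near: n; exact: Kq.
Unshelve. all: by end_near. Qed.

Lemma q_cvg0 (w : nat -> H) z :
  w n @[n --> \oo] --> z -> q (w n - z) @[n --> \oo] --> 0.
Proof.
move=> wz; apply: (@squeeze_cvgr _ _ _ _ (cst 0) (fun n => C * `|w n - z|)).
- by near=> n; rewrite seminorm_ge0 /= q_le.
- exact: cvg_cst.
- rewrite -(mulr0 C); apply: cvgM; first exact: cvg_cst.
  rewrite -(@normr0 _ H) -(subrr z); apply: cvg_norm.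
  by apply: cvgB => //; exact: cvg_cst.
Unshelve. all: by end_near. Qed.

Lemma fixed_of_cvg (w : nat -> H) z :
  w n @[n --> \oo] --> z -> T (w n) @[n --> \oo] --> z -> T z = z.
Proof.
move=> wz Twz; have Tw := T_cvg_of_q0 _ _ (q_cvg0 _ _ wz).
exact: (norm_cvg_unique Tw Twz).
Qed.

Lemma T_cvg_of_increments (w : nat -> H) (s : nat -> R) (b : R) :
  (forall n m, (n <= m)%N -> q (w m - w n) ^+ 2 <= s m - s n) ->
  (forall n, s n <= b) -> cvgn (T \o w).
Proof.
move=> ws sb; apply: (@cvg_of_increments _ _ _ (fun n => K ^+ 2 * s n)
  (K ^+ 2 * b)) => [n m nm|n]; last by rewrite ler_wpM2l ?sqr_ge0.
rewrite -mulrBr (le_trans _ (ler_wpM2l (sqr_ge0 K) (ws n m nm)))//.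
rewrite -exprMn ler_sqr ?nnegrE ?normr_ge0 ?mulr_ge0 ?seminorm_ge0//.
exact: T_lip.
Qed.

(** Summable [q]-steps: [q (w m - w n)] is at most [s m - s n], whose square
    is at most a constant times itself. *)
Lemma T_cvg_of_steps (w : nat -> H) (s : nat -> R) (b : R) :
  (forall n, q (w n.+1 - w n) <= s n.+1 - s n) ->
  (forall n, s n <= b) -> cvgn (T \o w).
Proof.
move=> ws sb.
have wsm n m : (n <= m)%N -> q (w m - w n) <= s m - s n.
  elim: m => [|m IH].
    by rewrite leqn0 => /eqP ->; rewrite !subrr seminorm0.
  rewrite leq_eqVlt => /predU1P[<-|].
    by rewrite !subrr seminorm0.
  rewrite ltnS => /IH wmn.
  have -> : w m.+1 - w n = (w m.+1 - w m) + (w m - w n) by rewrite addrA subrK.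
  rewrite (le_trans (seminormD hB _ _))//; have := ws m; lra.
apply: (@T_cvg_of_increments _ (fun n => (b - s 0%N) * s n) ((b - s 0%N) * b)).
  move=> n m nm; have := wsm n m nm; have := wsm 0%N n (leq0n n).
  have := seminorm_ge0 (B := B) (w m - w n).
  have := seminorm_ge0 (B := B) (w n - w 0%N).
  by have := sb m; rewrite -mulrBr expr2; nra.
move=> n; rewrite ler_wpM2l// subr_ge0 //.
Qed.

(** With [d = u - v] and [e = T u - T v], expanding [0 <= B (d - e) (d - e)]
    gives [2 B d e <= B d d + B e e <= 2 B d d]. *)
Lemma displacement_monotone u v :
  0 <= B ((u - T u) - (v - T v)) (u - v).
Proof.
have := T_nonexpansive u v.
rewrite seminorm_le// ?seminorm_ge0// sqr_seminorm//.
rewrite (_ : (u - T u) - _ = (u - v) - (T u - T v)); last first.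
  by rewrite opprD addrACA -opprD.
move: (u - v) (T u - T v) => d e.
have := semi_inner_ge0 hB (d - e); rewrite !BE (BC e d); lra.
Qed.

(** * The path of approximate fixed points *)

(** The map [v |-> t x0 + (1 - t) T v] is a [q]-contraction.  Since [q]
    may be neither definite nor complete, its iterates are shown to converge in norm
    through their images under [T]. *)
Lemma path_point_exists x0 t : 0 < t <= 1 ->
  exists z, z = t *: x0 + (1 - t) *: T z.
Proof.
move=> /andP[t0 t1].
pose S v := t *: x0 + (1 - t) *: T v.
pose w n := iter n S x0.
have Sq u v : q (S u - S v) <= (1 - t) * q (u - v).
  have -> : S u - S v = (1 - t) *: (T u - T v).
    by rewrite /S opprD addrACA subrr add0r scalerBr.
  by rewrite seminormZ ?subr_ge0// ler_wpM2l ?subr_ge0.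
have wq n : q (w n.+1 - w n) <= (1 - t) ^+ n * q (S x0 - x0).
  elim: n => [|n IH]; first by rewrite expr0 mul1r.
  by rewrite (le_trans (Sq _ _))// exprS -mulrA ler_wpM2l// subr_ge0.
have /cvg_ex[/= z' Twz'] : cvgn (T \o w).
  apply: (@T_cvg_of_steps _ (fun n => - ((1 - t) ^+ n * q (S x0 - x0) / t)) 0).
    move=> n; rewrite (le_trans (wq n))// exprS le_eqVlt; apply/orP; left.
    by apply/eqP; field; rewrite gt_eqF.
  move=> n; rewrite oppr_le0 divr_ge0 ?mulr_ge0 ?seminorm_ge0 ?exprn_ge0 ?(ltW t0)//.
  by rewrite subr_ge0.
have wz : w n @[n --> \oo] --> t *: x0 + (1 - t) *: z'.
  rewrite -cvg_shiftS /=; apply: cvgD; first exact: cvg_cst.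
  by apply: cvgZ => //; exact: cvg_cst.
exists (t *: x0 + (1 - t) *: z').
congr (_ + _ *: _).
exact: (norm_cvg_unique Twz' (T_cvg_of_q0 _ _ (q_cvg0 _ _ wz))).
Qed.

Lemma path_displacement x0 t z v : z = t *: x0 + (1 - t) *: T z ->
  (1 - t) * B (z - T z) v = t * B (x0 - z) v.
Proof.
by move=> zE; have := congr1 (fun w => B w v) zE; rewrite !BE; lra.
Qed.

(** Testing the monotonicity of [I - T] on two points of the path makes
    [B (z - x0) (z - x0)] increase as [t] decreases, with an increase that
    dominates the squared distance; being bounded by [path_bounded], it
    controls the path as in the Cauchy criterion. *)
Lemma path_increment x0 t t' z z' : 0 < t' -> t' < t -> t < 1 ->
  z = t *: x0 + (1 - t) *: T z -> z' = t' *: x0 + (1 - t') *: T z' ->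
  B (z' - z) (z' - z) <= B (z' - x0) (z' - x0) - B (z - x0) (z - x0).
Proof.
move=> t'0 tt' t1 zE z'E.
have dE := path_displacement _ _ _ (z - z') zE.
have d'E := path_displacement _ _ _ (z - z') z'E.
have mono := displacement_monotone z z'.
set a := z - x0; set a' := z' - x0.
have zz' : z - z' = a - a' by rewrite /a /a' opprB addrA subrK.
have x0z : x0 - z = - a by rewrite opprB.
have x0z' : x0 - z' = - a' by rewrite opprB.
have -> : z' - z = - (a - a') by rewrite -zz' opprB.
have key : 0 <= - (t * (1 - t')) * B a (a - a') + (t' * (1 - t)) * B a' (a - a').
  have -> : - (t * (1 - t')) * B a (a - a') = (1 - t') * (t * B (x0 - z) (z - z')).
    by rewrite x0z zz' !BE; ring.
  have -> : (t' * (1 - t)) * B a' (a - a') = - ((1 - t) * (t' * B (x0 - z') (z - z'))).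
    by rewrite x0z' zz' !BE; ring.
  rewrite -dE -d'E.
  have -> : (1 - t') * ((1 - t) * B (z - T z) (z - z')) -
    (1 - t) * ((1 - t') * B (z' - T z') (z - z')) =
    (1 - t) * (1 - t') * B ((z - T z) - (z' - T z')) (z - z').
    by rewrite !BE; ring.
  by rewrite !mulr_ge0// subr_ge0; lra.
(* Polarization of [B a a'] turns [key] into
   [(s + s') * |a - a'|^2 <= (s - s') * (|a'|^2 - |a|^2)]. *)
have := semi_inner_ge0 hB (a - a').
move: key; clearbody a a'; rewrite !BE (BC a' a).
set s := t * (1 - t'); set s' := t' * (1 - t).
have ss' : 0 < s - s' by rewrite /s /s'; lra.
have s'0 : 0 < s' by rewrite /s' mulr_gt0// subr_gt0.
move: (B a a) (B a a') (B a' a') => X Y Z k p.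
have {}k : (s + s') * (X - 2 * Y + Z) <= (s - s') * (Z - X) by lra.
have ZX : 0 <= Z - X.
  rewrite -(pmulr_rge0 _ ss') (le_trans _ k)// mulr_ge0 //; lra.
suff : (s + s') * (X - 2 * Y + Z) <= (s + s') * (Z - X).
  by rewrite ler_pM2l; lra.
by rewrite (le_trans k)// ler_wpM2r//; lra.
Qed.

Lemma path_bounded x0 t z p : 0 < t <= 1 -> T p = p ->
  z = t *: x0 + (1 - t) *: T z -> B (z - x0) (z - x0) <= B (p - x0) (p - x0).
Proof.
move=> /andP[t0 t1] pE zE.
have := displacement_monotone z p; rewrite pE subrr subr0 => mono.
have : 0 <= t * B (x0 - z) (z - p).
  by rewrite -(path_displacement _ _ _ _ zE) mulr_ge0// subr_ge0.
rewrite pmulr_rge0//.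
have -> : p - x0 = (z - x0) - (z - p) by rewrite opprB [RHS]addrC addrA subrK.
rewrite -(opprB z x0); move: (z - x0) (z - p) => a b.
have := semi_inner_ge0 hB b; rewrite !BE (BC b a); lra.
Qed.

(** For a point [w] of the path with parameter [t], monotonicity of [I - T]
    gives [t * B (x0 - w) (y - w) <= (1 - t) * B (y - T y) (y - w)]; the
    right-hand side vanishes along approximate fixed points, and then [w] may
    tend to the limit [z] of the path. *)
Lemma browder_limit (x0 p : H) : T p = p ->
  exists z, T z = z /\
    forall (y : nat -> H) (D : R), (forall k, q (y k - z) <= D) ->
      q (y k - T (y k)) @[k --> \oo] --> 0 ->
      forall e, 0 < e -> \forall k \near \oo, B (x0 - z) (y k - z) <= e.
Proof.
move=> pE.
(* The shift keeps the parameters strictly below 1. *)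
pose t n : R := harmonic n.+1.
have t0 n : 0 < t n by exact: harmonic_gt0.
have t1 n : t n < 1 by rewrite /t /harmonic /= invf_lt1 ?ltr1n ?ltr0n.
have t_decr n m : (n < m)%N -> t m < t n.
  by move=> nm; rewrite /t /harmonic /= ltf_pV2 ?posrE ?ltr0n// ltr_nat.
have t01 n : 0 < t n <= 1 by rewrite t0 ltW.
have /choice[w wE] n := path_point_exists x0 (t n) (t01 n).
have /cvg_ex[/= z Twz] : cvgn (T \o w).
  apply: (@T_cvg_of_increments _ (fun n => B (w n - x0) (w n - x0))
     (B (p - x0) (p - x0))); last first.
    by move=> n; exact: path_bounded (t01 n) pE (wE n).
  move=> n m; rewrite leq_eqVlt => /predU1P[<-|nm].
    by rewrite !subrr seminorm0// expr0n.
  by rewrite sqr_seminorm//; exact: path_increment (t0 m) (t_decr _ _ nm) (t1 n) (wE n) (wE m).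
have wz : w n @[n --> \oo] --> z.
  apply: (@anchored_cvg _ _ t w (T \o w) x0 z) => //.
  by rewrite /t (cvg_shiftS (@harmonic R)); exact: cvg_harmonic.
have Tz : T z = z by exact: fixed_of_cvg wz Twz.
exists z; split => // y D yD yT e e0.
have D0 : 0 <= D by rewrite (le_trans _ (yD 0%N))// seminorm_ge0.
pose E := q (p - x0).
have E0 : 0 <= E by exact: seminorm_ge0.
have wx0 n : q (x0 - w n) <= E.
  by rewrite seminormBC// ler_wsqrtr// (path_bounded _ _ _ _ (t01 n) pE (wE n)).
have d0 : 0 < e / 2 / (E + D + 1) by rewrite !divr_gt0//; lra.
have [n wn] : exists n, q (w n - z) <= e / 2 / (E + D + 1).
  have [N _ wN] := cvgr0_norm_le _ (q_cvg0 _ _ wz) _ d0.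
  by exists N; rewrite (le_trans (ler_norm _))// wN /=.
have q0 := seminorm_ge0 (B := B).
have {}wn : (E + D) * q (w n - z) <= e / 2.
  move: wn; rewrite ler_pdivlMr; last by lra.
  by have := q0 (w n - z); lra.
have F0 : 0 < e / 2 * t n / (D + q (w n - z) + 1).
  by rewrite divr_gt0 ?mulr_gt0 ?divr_gt0//; have := q0 (w n - z); lra.
near=> k.
have yk : q (y k - T (y k)) <= e / 2 * t n / (D + q (w n - z) + 1).
  rewrite (le_trans (ler_norm _))//; near: k; exact: cvgr0_norm_le yT _ F0.
have {}yk : q (y k - T (y k)) * (D + q (w n - z)) <= t n * (e / 2).
  move: yk; rewrite ler_pdivlMr; last by have := q0 (w n - z); lra.
  by have := q0 (y k - T (y k)); lra.
have first : B (x0 - w n) (y k - w n) <= e / 2.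
  rewrite -(ler_pM2l (t0 n)) -(path_displacement _ _ _ _ (wE n)).
  have mono : B (w n - T (w n)) (y k - w n) <= B (y k - T (y k)) (y k - w n).
    have := displacement_monotone (y k) (w n).
    by rewrite (semi_innerDl hB) (semi_innerNl hB) subr_ge0.
  have yw : q (y k - w n) <= D + q (w n - z).
    have -> : y k - w n = (y k - z) - (w n - z) by rewrite opprB addrA subrK.
    by rewrite (le_trans (seminormB hB _ _))// lerD2r.
  have Byk : B (y k - T (y k)) (y k - w n) <= q (y k - T (y k)) * (D + q (w n - z)).
    by rewrite (le_trans (semi_inner_le hB _ _))// ler_wpM2l.
  have ? := t0 n; have ? := t1 n; have ? := q0 (y k - T (y k)).
  have ? := q0 (w n - z).
  have ? : 0 <= q (y k - T (y k)) * (D + q (w n - z)) by rewrite mulr_ge0//; lra.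
  have ? : B (w n - T (w n)) (y k - w n) <= q (y k - T (y k)) * (D + q (w n - z)) by lra.
  by nra.
have -> : B (x0 - z) (y k - z) = B (x0 - w n) (y k - w n) +
    B (x0 - w n) (w n - z) + B (w n - z) (y k - z).
  by rewrite !BE; ring.
have ? : B (x0 - w n) (w n - z) <= E * q (w n - z).
  by rewrite (le_trans (semi_inner_le hB _ _))// ler_wpM2r.
have ? : B (w n - z) (y k - z) <= q (w n - z) * D.
  by rewrite (le_trans (semi_inner_le hB _ _))// ler_wpM2l.
by lra.
Unshelve. all: by end_near. Qed.

(** * Halpern iteration with adaptive anchoring *)

Section AdaptiveHalpern.
Context {x : nat -> H} {phi : nat -> R}.
(** Here [phi k] is the parameter used to pass from [x k] to [x k.+1]. *)
Hypothesis r_neq0 : forall k, q (x k - T (x k)) != 0.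
Hypothesis phiE : forall k,
  phi k = 2 * B (x k - T (x k)) (x 0%N - x k) / q (x k - T (x k)) ^+ 2 + 1.
Hypothesis xE : forall k, x k.+1 =
  (1 / (phi k + 1)) *: x 0%N + (phi k / (phi k + 1)) *: T (x k).

Let rr_gt0 k : 0 < B (x k - T (x k)) (x k - T (x k)).
Proof. by rewrite -sqr_seminorm// exprn_gt0// lt0r r_neq0 seminorm_ge0. Qed.

Let phi_rr k : phi k * B (x k - T (x k)) (x k - T (x k)) =
  2 * B (x k - T (x k)) (x 0%N - x k) + B (x k - T (x k)) (x k - T (x k)).
Proof.
have rr := rr_gt0 k; rewrite phiE sqr_seminorm//.
by field; rewrite gt_eqF.
Qed.

(** With [u = x_(k+1) - T x_k], [r] and [s] the displacements at [x_(k+1)]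
    and [x_k], the value of [phi k] is exactly the one giving
    [B s s = 2 B u s], that is [|u - s| = |u|] in seminorm.  Nonexpansiveness
    [|u - r| <= |u - s|] then reads [B r r <= 2 B u r], and
    [x_0 - x_(k+1) = phi_k u]. *)
Lemma phi_step k : 0 < phi k -> phi k + 1 <= phi k.+1.
Proof.
move=> phik; rewrite -(ler_pM2r (rr_gt0 k.+1)) phi_rr.
have phi1 : phi k + 1 != 0 by rewrite gt_eqF//; lra.
have := T_nonexpansive (x k.+1) (x k).
rewrite seminorm_le// ?seminorm_ge0// sqr_seminorm//.
set u := x k.+1 - T (x k); set r := x k.+1 - T (x k.+1).
have x0u : x 0%N - x k.+1 = phi k *: u.
  have uE : u = (1 / (phi k + 1)) *: (x 0%N - T (x k)).
    rewrite /u xE scalerBr -addrA; congr (_ + _).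
    by rewrite -[in LHS]scaleN1r -scalerDl -scaleNr; congr (_ *: _); field.
  rewrite -(subrK (T (x k)) (x k.+1)) -/u opprD addrCA addrC uE scalerA.
  by rewrite -{1}(scale1r (x 0%N - _)) -scalerBl; congr (_ *: _); field.
have := phi_rr k; set s := x k - T (x k).
have -> : x 0%N - x k = (phi k *: u) + (u - s).
  by rewrite -x0u /u /s opprB !subrKA.
have -> : x k.+1 - x k = u - s by rewrite /u /s opprB addrA subrK.
have -> : T (x k.+1) - T (x k) = u - r.
  by rewrite /u /r opprB [RHS]addrC subrKA.
rewrite x0u; clearbody u r s; rewrite !BE (BC s u) (BC r u).
move: (phi k) phik phi1 => f f0 f1 Ess Err.
have {}Ess : B s s = 2 * B u s.
  by apply: (mulfI f1); lra.
nra.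
Qed.

(** The anchor is the starting point, whence [phi 0 = 1]. *)
Lemma phi_ge k : k.+1%:R <= phi k.
Proof.
elim: k => [|k IH].
  by rewrite phiE subrr -(scale0r (x 0%N)) (semi_innerZr hB) mul0r mulr0 mul0r add0r.
rewrite -natr1 (le_trans _ (phi_step k _)) ?lerD2r// (lt_le_trans _ IH)//.
Qed.

Let phi_ge1 k : 1 <= phi k.
Proof. by rewrite (le_trans _ (phi_ge k))// ler1n. Qed.

(** Nonexpansiveness towards [p] says [2 B r (x_k - p) >= B r r]; the
    defining equation of [phi k] exchanges [x_k] for [x_0] and the conclusion
    is Cauchy-Schwarz. *)
Lemma residual_le p k : T p = p -> phi k * q (x k - T (x k)) <= 2 * q (x 0%N - p).
Proof.
move=> pE; have r0 := rr_gt0 k.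
have rp : 0 < q (x k - T (x k)) by rewrite lt0r r_neq0 seminorm_ge0.
rewrite -(ler_pM2r rp) -mulrA -expr2 sqr_seminorm// phi_rr.
have CS := semi_inner_le hB (x k - T (x k)) (x 0%N - p).
have := T_nonexpansive (x k) p; rewrite pE seminorm_le// ?seminorm_ge0// sqr_seminorm//.
have -> : T (x k) - p = (x k - p) - (x k - T (x k)).
  by rewrite opprB [RHS]addrC addrA subrK.
have e : x 0%N - x k = (x 0%N - p) - (x k - p) by rewrite opprB addrA subrK.
move: CS; rewrite e; move: (x k - T (x k)) (x 0%N - p) (x k - p) => r a b.
rewrite !BE (BC r b); lra.
Qed.

Let a k : R := 1 / (phi k + 1).

Let aE k : x k.+1 = a k *: x 0%N + (1 - a k) *: T (x k).
Proof.
rewrite xE; congr (_ + _ *: _); rewrite /a; have := phi_ge1 k => ?.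
by field; rewrite gt_eqF//; lra.
Qed.

Let a01 k : 0 <= a k <= 1.
Proof.
have := phi_ge1 k => ?; rewrite /a divr_ge0//=; last by lra.
by rewrite ler_pdivrMr; lra.
Qed.

Lemma pha_bounded p k : T p = p -> q (x k - p) <= q (x 0%N - p).
Proof.
move=> pE; elim: k => // k IH; have /andP[a0 a1] := a01 k.
have -> : x k.+1 - p = a k *: (x 0%N - p) + (1 - a k) *: (T (x k) - p).
  rewrite aE !scalerBr addrACA; congr (_ + _).
  by rewrite -opprD -scalerDl addrC subrK scale1r.
rewrite (le_trans (seminormD hB _ _))// !seminormZ ?subr_ge0//.
have := T_nonexpansive (x k) p; rewrite pE => Txp.
have := le_trans Txp IH; nra.
Qed.

(** The step is [a_k (x_0 - T x_k) - r_k].  The first part is at most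
    [2 q (x_0 - p) a_k], and [residual_le] bounds the second by
    [4 q (x_0 - p) a_k] because [phi_k >= 1] gives [phi_k + 1 <= 2 phi_k]. *)
Lemma pha_step_le p k : T p = p -> q (x k.+1 - x k) <= 6 * q (x 0%N - p) * a k.
Proof.
move=> pE; have /andP[a0 a1] := a01 k.
have -> : x k.+1 - x k = a k *: ((x 0%N - p) - (T (x k) - p)) - (x k - T (x k)).
  rewrite [- (T (x k) - p)]opprB subrKA aE scalerBr scalerBl scale1r.
  by rewrite opprB !addrA; congr (_ - _); rewrite addrAC.
rewrite (le_trans (seminormB hB _ _))// seminormZ//.
have h1 := seminormB hB (x 0%N - p) (T (x k) - p).
have h2 := T_nonexpansive (x k) p; rewrite pE in h2.
have h3 := pha_bounded p k pE.
have h4 := residual_le p k pE.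
have ph := phi_ge1 k.
have r0 := seminorm_ge0 (B := B) (x k - T (x k)).
have h5 : q (x k - T (x k)) <= 4 * q (x 0%N - p) * a k.
  by rewrite /a mul1r ler_pdivlMr; nra.
nra.
Qed.

(** Expand [(1 - a_k) (T x_k - z) = (x_(k+1) - z) - a_k (x_0 - z)] and drop
    the nonnegative square of the last term. *)
Lemma halpern_step z k :  T z = z ->
  B (x k.+1 - z) (x k.+1 - z) <= (1 - a k) * B (x k - z) (x k - z) +
    a k * (2 * B (x 0%N - z) (x k.+1 - z)).
Proof.
move=> zE; have /andP[a0 a1] := a01 k.
have := T_nonexpansive (x k) z; rewrite seminorm_le// ?seminorm_ge0// sqr_seminorm// zE.
have -> : x k.+1 - z = a k *: (x 0%N - z) + (1 - a k) *: (T (x k) - z).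
  rewrite aE !scalerBr addrACA; congr (_ + _).
  by rewrite -opprD -scalerDl addrC subrK scale1r.
move: (x 0%N - z) (T (x k) - z) (B (x k - z) (x k - z)) => u v e.
have := semi_inner_ge0 hB u; have := semi_inner_ge0 hB v.
rewrite !BE (BC v u); move: (a k) a0 a1 => t t0 t1 vv uu le.
have : t ^+ 2 * B u u >= 0 by rewrite mulr_ge0// sqr_ge0.
have : (1 - t) * ((1 - t) * B v v) <= (1 - t) * e.
  by rewrite ler_wpM2l ?subr_ge0//; nra.
lra.
Qed.

Theorem pha_cvg p : T p = p ->
  exists z, T z = z /\ x k @[k --> \oo] --> z.
Proof.
move=> pE.
have a_cvg0 : a n @[n --> \oo] --> 0.
  apply: (@squeeze_cvgr _ _ _ _ (cst 0) harmonic); [|exact: cvg_cst|exact: cvg_harmonic].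
  near=> n; have /andP[-> _]/= := a01 n.
  have := phi_ge n; have := phi_ge1 n => ? ?.
  by rewrite /a mul1r lef_pV2 ?posrE ?ltr0n//; lra.
have x_cvg (z : H) : T (x n) @[n --> \oo] --> z -> x n @[n --> \oo] --> z.
  move=> Txz; rewrite -cvg_shiftS /=.
  exact: (@anchored_cvg _ _ a (fun n => x n.+1) (T \o x) (x 0%N) z a_cvg0 Txz aE).
have D0 := seminorm_ge0 (B := B) (x 0%N - p).
have [[b ab]|a_unbounded] := pselect (exists b, forall n, \sum_(i < n) a i <= b).
  have /cvg_ex[/= z Txz] : cvgn (T \o x).
    apply: (@T_cvg_of_steps _ (fun n => 6 * q (x 0%N - p) * \sum_(i < n) a i)
       (6 * q (x 0%N - p) * b)) => n.
      rewrite big_ord_recr/= mulrDr addrAC subrr add0r.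
      exact: pha_step_le.
    by rewrite ler_wpM2l ?mulr_ge0.
  by exists z; split; [exact: fixed_of_cvg (x_cvg _ Txz) Txz | exact: x_cvg].
have {}a_unbounded b : exists n, b < \sum_(i < n) a i.
  apply: contrapT => nb; apply: a_unbounded; exists b => n.
  by rewrite leNgt; apply/negP => bn; apply: nb; exists n.
have [z [zE lim_le]] := browder_limit (x 0%N) p pE.
have r_cvg0 : q (x k - T (x k)) @[k --> \oo] --> 0.
  apply: (@squeeze_cvgr _ _ _ _ (cst 0) (fun n => 2 * q (x 0%N - p) * harmonic n)).
  - near=> n; rewrite seminorm_ge0/= ler_pdivlMr ?ltr0n//.
    rewrite (le_trans _ (residual_le p n pE))// mulrC ler_wpM2r ?seminorm_ge0//.
    exact: phi_ge.
  - exact: cvg_cst.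
  - rewrite -(mulr0 (2 * q (x 0%N - p))); apply: cvgM; first exact: cvg_cst.
    exact: cvg_harmonic.
have {}lim_le := lim_le x (q (x 0%N - z)) (fun k => pha_bounded z k zE) r_cvg0.
exists z; split => //; apply: x_cvg; rewrite -[X in _ --> X]zE.
apply: T_cvg_of_q0; apply/cvgr0Pnorm_le => e e0.
have d0 : 0 < e ^+ 2 / 4 by rewrite divr_gt0 ?exprn_gt0.
have [N _ leN] := lim_le _ d0.
have e20 : 0 < e ^+ 2 / 2 by rewrite divr_gt0 ?exprn_gt0.
have rec k : (N <= k)%N -> B (x k.+1 - z) (x k.+1 - z) <=
    (1 - a k) * B (x k - z) (x k - z) + a k * (e ^+ 2 / 2).
  move=> Nk; rewrite (le_trans (halpern_step z k zE))// lerD2l.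
  have /andP[a0 _] := a01 k; rewrite ler_wpM2l//.
  by have := leN k.+1 (leqW Nk); rewrite /=; lra.
have := @averaged_eventually_le _ (fun k => B (x k - z) (x k - z)) a (e ^+ 2 / 2) N
  e20 (fun k => semi_inner_ge0 hB _) a01 rec a_unbounded.
apply: filterS => k; rewrite mulrC divfK// => le.
by rewrite ger0_norm ?seminorm_ge0// seminorm_le// ltW.
Unshelve. all: by end_near. Qed.

End AdaptiveHalpern.
End DegenerateNonexpansive.

(** * Resolvents preconditioned by a positive semidefinite operator *)

Section Preconditioner.
Context {R : realType} {H : completeNormedModType R}.
Context {dot : {dot H for idfun}} {A : H -> set H} {M : {linear H -> H}}.

Lemma semi_inner_dot : semi_inner dot.
Proof.
split=> [u v|u v w|a u v|u].
- by rewrite hermC expr0 mul1r.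
- by rewrite linearDl.
- by rewrite linearZl_LR.
- have [->|u0] := eqVneq u 0; first by rewrite linear0l.
  exact/ltW/neq0_dnorm_gt0.
Qed.

Lemma semi_inner_dotM : self_adjoint dot M -> positive_semidefinite dot M ->
  semi_inner (dotM dot M).
Proof.
move=> Msa Mpos; have hd := semi_inner_dot.
split=> [u v|u v w|a u v|u]; rewrite /dotM.
- by rewrite Msa (semi_innerC hd).
- by rewrite linearD (semi_innerDl hd).
- by rewrite linearZ (semi_innerZl hd).
- exact: Mpos.
Qed.

Hypothesis dot_norm : induces_norm dot.

Lemma norm_seminorm v : `|v| = seminorm dot v.
Proof. exact: dot_norm. Qed.

Lemma seminormM_le (C : R) : 0 <= C -> (forall v, `|M v| <= C * `|v|) ->
  self_adjoint dot M -> positive_semidefinite dot M ->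
  forall v, seminorm (dotM dot M) v <= Num.sqrt C * `|v|.
Proof.
move=> C0 MC Msa Mpos v.
rewrite seminorm_le ?mulr_ge0 ?sqrtr_ge0//; last exact: semi_inner_dotM.
rewrite exprMn sqr_sqrtr// /dotM (le_trans (semi_inner_le semi_inner_dot _ _))//.
by rewrite -!norm_seminorm expr2 mulrA ler_wpM2r.
Qed.

(** Since [|M v|^2 = B v (M v)], Cauchy-Schwarz for [B] and the bound of
    [seminormM_le] at [M v] leave one factor [|M v|] to cancel. *)
Lemma normM_le (C : R) : 0 <= C -> (forall v, `|M v| <= C * `|v|) ->
  self_adjoint dot M -> positive_semidefinite dot M ->
  forall v, `|M v| <= Num.sqrt C * seminorm (dotM dot M) v.
Proof.
move=> C0 MC Msa Mpos v; have hM := semi_inner_dotM Msa Mpos.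
have [->|Mv0] := eqVneq (M v) 0.
  by rewrite normr0 mulr_ge0 ?sqrtr_ge0.
have Mvp : 0 < `|M v| by rewrite normr_gt0.
rewrite -(ler_pM2r Mvp) -expr2.
have -> : `|M v| ^+ 2 = dotM dot M v (M v).
  by rewrite norm_seminorm (sqr_seminorm semi_inner_dot).
rewrite (le_trans (semi_inner_le hM _ _))// mulrAC mulrC.
by rewrite ler_wpM2r ?seminorm_ge0 ?seminormM_le.
Qed.

Context {T : H -> H}.
Hypothesis TE : forall y, precond_resolvent A M y = [set T y].

Lemma resolventP y z : T y = z <-> A z (M y - M z).
Proof.
have -> : T y = z <-> precond_resolvent A M y z.
  by rewrite TE /=; split => ->.
split=> [[_ -> [_ [v [-> Av ->]]]]|Az]; first by rewrite addrC addKr.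
by exists (M y) => //; exists (M z), (M y - M z); split => //; rewrite addrC subrK.
Qed.

Lemma zer_fixed z : zer A z <-> T z = z.
Proof. by rewrite resolventP subrr. Qed.

(** Monotonicity of [A] at [T u] and [T v] is firm nonexpansiveness,
    [0 <= B (d - e) e] with [d = u - v] and [e = T u - T v]. *)
Lemma resolvent_nonexpansive : monotone_op dot A ->
  self_adjoint dot M -> positive_semidefinite dot M ->
  forall u v, seminorm (dotM dot M) (T u - T v) <= seminorm (dotM dot M) (u - v).
Proof.
move=> Amono Msa Mpos u v; have hM := semi_inner_dotM Msa Mpos.
have /resolventP Au := erefl (T u); have /resolventP Av := erefl (T v).
have := Amono _ _ _ _ Au Av.
rewrite (_ : _ - (M v - M (T v)) = M ((u - v) - (T u - T v))); last first.
  by rewrite !(raddfB M) opprD addrACA -opprD.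
rewrite (semi_innerC semi_inner_dot) -/(dotM dot M _ _).
rewrite seminorm_le ?seminorm_ge0// sqr_seminorm//.
move: (u - v) (T u - T v) => d e; have := semi_inner_ge0 hM (d - e).
rewrite !(semi_innerE hM) (semi_innerC hM e d); lra.
Qed.

Lemma resolvent_lipschitz (L : R) : 0 <= L ->
  (forall y y' z z', op_inv (op_add (op_fun M) A) y z ->
     op_inv (op_add (op_fun M) A) y' z' -> `|z - z'| <= L * `|y - y'|) ->
  forall u v, `|T u - T v| <= L * `|M (u - v)|.
Proof.
move=> L0 hL u v; rewrite linearB /=; apply: hL.
- have /resolventP Au := erefl (T u).
  by exists (M (T u)), (M u - M (T u)); split => //; rewrite addrC subrK.
- have /resolventP Av := erefl (T v).
  by exists (M (T v)), (M v - M (T v)); split => //; rewrite addrC subrK.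
Qed.

End Preconditioner.

Theorem corollary3p1 (R : realType) (H : completeNormedModType R)
    (dot : {dot H for idfun}) (A : H -> set H) (M : {linear H -> H})
    (T : H -> H) (x : nat -> H) :
  induces_norm dot ->
  maximal_monotone dot A ->
  zer A !=set0 ->
  admissible_preconditioner dot A M ->
  op_lipschitz (op_inv (op_add (op_fun M) A)) ->
  (forall y : H, precond_resolvent A M y = [set T y]) ->
  (forall k : nat, (1 <= k)%N -> normM dot M (x k.-1 - T (x k.-1)) != 0) ->
  pha_iteration dot M T x ->
  exists z : H, zer A z /\ x k @[k --> \oo] --> z.
Proof.
move=> dot_norm [Amono _] [p Ap] [[C0 MC0] Msa Mpos _ _] [L0 hL0] TE r_neq0 xE.
(* The given constants carry no sign, and inequalities get multiplied by them. *)
pose C := Num.max C0 0; pose L := Num.max L0 0.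
have C_ge0 : 0 <= C by rewrite le_max lexx orbT.
have L_ge0 : 0 <= L by rewrite le_max lexx orbT.
have MC v : `|M v| <= C * `|v|.
  by rewrite (le_trans (MC0 v))// ler_wpM2r// le_max lexx.
have hL y y' z z' : op_inv (op_add (op_fun M) A) y z ->
    op_inv (op_add (op_fun M) A) y' z' -> `|z - z'| <= L * `|y - y'|.
  by move=> yz yz'; rewrite (le_trans (hL0 _ _ _ _ yz yz'))// ler_wpM2r// le_max lexx.
have T_lip u v : `|T u - T v| <= (L * Num.sqrt C) * seminorm (dotM dot M) (u - v).
  rewrite (le_trans (resolvent_lipschitz TE _ L_ge0 hL _ _))// -mulrA ler_wpM2l//.
  exact: normM_le.
have [z [zE xz]] := @pha_cvg _ _ _ T _ _ (semi_inner_dotM Msa Mpos)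
  (mulr_ge0 L_ge0 (sqrtr_ge0 C))
  (seminormM_le dot_norm _ C_ge0 MC Msa Mpos) (resolvent_nonexpansive TE Amono Msa Mpos) T_lip
  x (fun k => pha_phi dot M T x k.+1)
  (fun k => r_neq0 k.+1 isT) (fun k => erefl) (fun k => xE k.+1 isT)
  p ((zer_fixed TE p).1 Ap).
by exists z; split => //; apply/(zer_fixed TE).
Qed.
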